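(* Let $n\in\mathbb{N}$, let $T\in M(n;\mathbb{C})$ with $\mathrm{Im}\,T$ positive definite and $\det T\neq 0$, and let $\tau\in M(n;\mathbb{R})$ be an alternating matrix. Let $a=(a_1,\dots,a_n)\in M(n;\mathbb{Z})$, let $s:\mathbb{R}^n\to\mathbb{R}^n$ be a smooth function with $s(x+e_j)=s(x)+a_j$ for $j=1,\dots,n$ (used both as a function of $x$ and as a function of $\check{x}$), and let $q\in\mathbb{R}^n$. Then the twisted connection $\nabla^{\tau}_{(s,a,q)}$ is a twisted integrable connection on $E^{\tau}_{(s,a,q)}\to X^n_{\mathcal{G}_\tau^\nabla}$ if and only if the pair $\mathscr{L}^{\nabla}_{(s,a,q)}(\tau)=(L_{(s,a)},\mathcal{L}^\nabla_{(s,a,q)}(\tau))$ satisfies both of the following conditions: (1) $L_{(s,a)}$ is a Lagrangian submanifold in $\check{X}^n_{\mathcal{G}_\tau^\nabla}$; (2) $\mathcal{L}^\tau_{(s,a,q)}\to L_{(s,a)}$ with the twisted connection $\nabla_{\mathcal{L}^\tau_{(s,a,q)}}$ satisfies $\tilde\Omega_{\nabla_{\mathcal{L}^\tau_{(s,a,q)}}}=-\mathbf{i}B_\tau^\vee\big|_{L_{(s,a)}}$, where $\tilde\Omega_{\nabla_{\mathcal{L}^\tau_{(s,a,q)}}}$ is the ''local'' curvature form of $\nabla_{\mathcal{L}^\tau_{(s,a,q)}}$.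
   Context: Notation. $M(n;R)$ is the set of $n\times n$ matrices over $R$; $A^t$ is the transpose; $\mathbf{i}=\sqrt{-1}$; $e_j$ is the $j$-th standard basis vector; $a_j\in\mathbb{Z}^n$ is the $j$-th column of $a$. $T$ is not assumed symmetric. Alternating means $\tau^t=-\tau$. For vectors of 1-forms, $dx^tA\,dy:=\sum_{i,j}A_{ij}\,dx_i\wedge dy_j$, and similarly for $dx^tA\,dx$ etc. Twisted line bundles. For a trivial gerbe with 0-connection $\{d+\omega_{\alpha\beta}\}$ on double overlaps and 1-connection $\{B_\alpha\}$, an $id$-twisted line bundle is a line bundle given by transition functions $\varphi_{\alpha\beta}$ satisfying the ordinary cocycle condition, and a twisted connection on it is a family $\nabla_\alpha=d+\omega_\alpha$ with $\nabla_\beta-\varphi_{\alpha\beta}^{-1}\nabla_\alpha\varphi_{\alpha\beta}=\omega_{\alpha\beta}$ on overlaps. Its ''local'' curvature form is $\tilde\Omega_\alpha=d\omega_\alpha$ and its curvature form is the global 2-form $\Omega=\tilde\Omega_\alpha-B_\alpha$. Complex side. $X^n=\mathbb{C}^n/(\mathbb{Z}^n\oplus T\mathbb{Z}^n)$ has complex coordinates $z=x+Ty$, $x,y\in\mathbb{R}^n$, $x_i\sim x_i+1$, $y_i\sim y_i+1$. It is covered by the coordinate boxes $\frac{l_j-1}{3}-\epsilon<x_j<\frac{l_j}{3}+\epsilon$, $\frac{m_k-1}{3}-\epsilon<y_k<\frac{m_k}{3}+\epsilon$, with $l_j,m_k\in\{1,2,3\}$ and $\epsilon>0$ small. $\mathcal{G}_\tau^\nabla$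 is the trivial gerbe for this covering with 0-connection $d-\pi\mathbf{i}\,v^t\tau\,dx$ on the overlap of an ordered pair of boxes whose $x$-coordinates $x,x'$ are related by $x'=x+v$, $v\in\mathbb{Z}^n$, and 1-connection $-\pi\mathbf{i}\,dx^t\tau\,dx$. $X^n_{\mathcal{G}_\tau^\nabla}$ is $X^n$ equipped with this flat gerbe; types $(p,q)$ of forms are taken with respect to the complex structure of $X^n$. $E^\tau_{(s,a,q)}$ is the $id$-twisted line bundle whose local sections satisfy $\psi(x+e_j,y)=\exp(2\pi\mathbf{i}\,a_j^ty)\psi(x,y)$, $\psi(x,y+e_k)=\psi(x,y)$, with twisted connection $$\nabla^\tau_{(s,a,q)}=d-2\pi\mathbf{i}\,\bigl(s(x)^t+q^tT\bigr)dy-\pi\mathbf{i}\,x^t\tau\,dx .$$ It is a twisted integrable connection if the $(0,2)$-part of its curvature form $\Omega^\tau_{(s,a,q)}$ (the ''local'' curvature minus the 1-connection $-\pi\mathbf{i}\,dx^t\tau\,dx$) vanishes. Symplectic side. Let $\omega^\vee_{\rm mat}=\mathrm{Im}(-(T^{-1})^t)$, $B^\vee_{\rm mat}=\mathrm{Re}(-(T^{-1})^t)$. On $\mathbb{R}^{2n}/\mathbb{Z}^{2n}$ with coordinates $(\check{x},\check{y})$, $\check{x}=(x^1,\dots,x^n)^t$, $\check{y}=(y^1,\dots,y^n)^t$, put $\omega^\vee=2\pi\,d\check{x}^t\omega^\vee_{\rm mat}d\check{y}$ (a symplectic form), $B^\vee=2\pi\,d\check{x}^tB^\vee_{\rm mat}d\check{y}$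 and $B^\vee_\tau=B^\vee+\pi\,d\check{x}^t\tau\,d\check{x}$. Then $\check{X}^n_{\mathcal{G}_\tau^\nabla}=(\mathbb{R}^{2n}/\mathbb{Z}^{2n},\ \omega^\vee-\mathbf{i}B_\tau^\vee)$; Lagrangian submanifolds are $n$-dimensional submanifolds on which $\omega^\vee$ restricts to zero. Write $\tau=\tau_{\mathbb{Z}}+\tau_{\rm frac}$, where $\tau_{\mathbb{Z}},\tau_{\rm frac}$ are alternating with $(\tau_{\mathbb{Z}})_{ij}=\lfloor\tau_{ij}\rfloor$ and $(\tau_{\rm frac})_{ij}=\tau_{ij}-\lfloor\tau_{ij}\rfloor$ for $i<j$. The flat gerbe $\check{\mathcal{G}}^\nabla_{\tau_{\rm frac}}$ on $\mathbb{R}^{2n}/\mathbb{Z}^{2n}$ is defined as $\mathcal{G}_\tau^\nabla$ with $(x,y)$ replaced by $(\check{x},\check{y})$ and $\tau$ by $\tau_{\rm frac}$; its 1-connection is $-\pi\mathbf{i}\,d\check{x}^t\tau_{\rm frac}\,d\check{x}$. One regards $\check{X}^n_{\mathcal{G}_\tau^\nabla}$ as the deformation of $(\mathbb{R}^{2n}/\mathbb{Z}^{2n},\omega^\vee-\mathbf{i}(B^\vee+\pi d\check{x}^t\tau_{\mathbb{Z}}d\check{x}))$ by $\check{\mathcal{G}}^\nabla_{\tau_{\rm frac}}$. Let $L_{(s,a)}=\{(\check{x},s(\check{x}))\}\subset\mathbb{R}^{2n}/\mathbb{Z}^{2n}$, an $n$-dimensional submanifold parametrized by $\check{x}$. $\mathcal{L}^\tau_{(s,a,q)}\to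 L_{(s,a)}$ is the $id$-twisted line bundle whose local sections satisfy $\psi(\check{x}+e_i,s(\check{x})+a_i)=\exp(\pi\mathbf{i}\,(\tau_{\mathbb{Z}})_i^t\check{x})\,\psi(\check{x},s(\check{x}))$, $(\tau_{\mathbb{Z}})_i=((\tau_{\mathbb{Z}})_{i1},\dots,(\tau_{\mathbb{Z}})_{in})^t$, with twisted connection (relative to $\check{\mathcal{G}}^\nabla_{\tau_{\rm frac}}$) $$\nabla_{\mathcal{L}^\tau_{(s,a,q)}}=d-\pi\mathbf{i}\,\check{x}^t\tau_{\mathbb{Z}}d\check{x}-2\pi\mathbf{i}\,q^td\check{x}-\pi\mathbf{i}\,\check{x}^t\tau_{\rm frac}d\check{x},$$ and $\mathcal{L}^\nabla_{(s,a,q)}(\tau)=(\mathcal{L}^\tau_{(s,a,q)},\nabla_{\mathcal{L}^\tau_{(s,a,q)}})$. *)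

(* Defs.v *)
From HB Require Import structures.
From mathcomp Require Import all_boot all_order all_algebra.
From mathcomp Require Import all_classical all_reals all_analysis.
From mathcomp Require Import complex.

Set Implicit Arguments.
Unset Strict Implicit.
Unset Printing Implicit Defensive.

Import Order.TTheory GRing.Theory Num.Theory.
Import numFieldNormedType.Exports.

Local Open Scope classical_set_scope.
Local Open Scope ring_scope.
Local Open Scope complex_scope.

(** Tori are handled on their universal covers.  A subset of a torus is its
    preimage in the covering vector space, and a function or form on an open
    subset of a torus is written in the affine coordinates of a chart, so that
    charts are glued by lattice translations. *)

Section Smooth.
Context {R : realType} {V W : normedModType R}.

(** On an open set U, this is the usual class C^k on U. *)
Fixpoint Ck_on (k : nat) (U : set V) (f : V -> W) : Prop :=
  if k is k'.+1 then
    (forall x, U x -> differentiable f x) /\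
    (forall v : V, Ck_on k' U (fun x => 'D_v f x))
  else forall x, U x -> {for x, continuous f}.

Definition smooth_on (U : set V) (f : V -> W) : Prop :=
  forall k, Ck_on k U f.

End Smooth.

Section ComplexForms.
Context {R : realType}.

Definition csmooth_on (V : normedModType R) (U : set V) (f : V -> R[i]) : Prop :=
  smooth_on U (fun x => complex.Re (f x)) /\
  smooth_on U (fun x => complex.Im (f x)).

Definition cderive (V : normedModType R) (v : V) (f : V -> R[i]) (x : V) : R[i] :=
  'D_v (fun y => complex.Re (f y)) x +i* 'D_v (fun y => complex.Im (f y)) x.

(** exp (i t) *)
Definition expi (t : R) : R[i] := cos t +i* sin t.

(** Complex-valued forms: a point, then one or two (real) tangent vectors. *)
Definition oneform (V : normedModType R) := V -> V -> R[i].
Definition twoform (V : normedModType R) := V -> V -> V -> R[i].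

Definition smooth_oneform_on (V : normedModType R) (U : set V) (w : oneform V) :=
  (forall x, U x -> forall (c : R) (u v : V),
     w x (c *: u + v) = c%:C * w x u + w x v) /\
  (forall v, csmooth_on U (fun x => w x v)).

Definition dform (V : normedModType R) (w : oneform V) : twoform V :=
  fun x u v => cderive u (fun y => w y v) x - cderive v (fun y => w y u) x.

Definition pullback1 (P V : normedModType R) (f : P -> V) (w : oneform V) :
  oneform P := fun x u => w (f x) ('d f x u).
Definition pullback2 (P V : normedModType R) (f : P -> V) (w : twoform V) :
  twoform P := fun x u v => w (f x) ('d f x u) ('d f x v).

End ComplexForms.

Section Submanifold.
Context {R : realType} {V : normedModType R}.

Definition embedding (P : normedModType R) (sigma : P -> V) : Prop :=
  [/\ smooth_on [set: P] sigma,
      forall x, injective ('d sigma x) &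
      exists rho : V -> P,
        cancel sigma rho /\ {within range sigma, continuous rho}].

Definition submanifold (k : nat) (M : set V) : Prop :=
  forall p, M p -> exists (U : set V) (sigma : 'cV[R]_k -> V),
    [/\ open U, U p, embedding sigma & range sigma = M `&` U].

Definition tangent (M : set V) (p u : V) : Prop :=
  exists gamma : R -> V,
    [/\ gamma 0 = p, \forall t \near (0 : R), M (gamma t) &
        is_derive (0 : R) (1 : R) gamma u].

Definition lagrangian (k : nat) (omega : twoform V) (M : set V) : Prop :=
  submanifold k M /\
  forall p u v, M p -> tangent M p u -> tangent M p v -> omega p u v = 0.

End Submanifold.

(** A complexified symplectic form [sympl_form - i B_field]. *)
Record complexified_symplectic (R : realType) (V : normedModType R) := {
  sympl_form : twoform V;
  B_field : twoform V }.

Section Gerbes.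
Context {R : realType}.

(** A trivial gerbe on a torus V / L.  A point of the overlap of the patches
    al and be has a coordinate p in al and a coordinate p + gshift lam in be;
    the 0-connection on that part of the overlap is d + conn0 al be lam, in the
    coordinate p of al.  The 1-connection is the family conn1. *)
Record gerbe (V : normedModType R) (L : zmodType) := Gerbe {
  gidx : Type;
  gshift : L -> V;
  chart : gidx -> set V;
  conn0 : gidx -> gidx -> L -> oneform V;
  conn1 : gidx -> twoform V }.

Definition overlap V L (G : gerbe V L) (al be : gidx G) (lam : L) : set V :=
  [set p | chart al p /\ chart be (p + gshift G lam)].

(** Restriction along a map iota : P -> V with
    iota (x + sh v) = iota x + gshift (h v).  The coordinate x on P is kept on
    every patch; the patch (al, mu) consists of the x for which
    iota x + gshift (k mu) is the coordinate in al of the image of x, so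
    k : M -> L has to reach the translations that are needed to cover P / L'.
    [restr_coord] is the inclusion in these coordinates. *)
Definition restr_coord (P V : normedModType R) (L : zmodType) (M : Type)
    (G : gerbe V L) (iota : P -> V) (k : M -> L) (mu : M) (x : P) : V :=
  iota x + gshift G (k mu).

Definition gerbe_restr (P V : normedModType R) (L L' : zmodType) (M : Type)
    (G : gerbe V L) (sh : L' -> P) (iota : P -> V) (h : L' -> L) (k : M -> L) :
  gerbe P L' :=
  {| gidx := (gidx G * M)%type;
     gshift := sh;
     chart := fun a => [set x | chart a.1 (restr_coord G iota k a.2 x)];
     conn0 := fun a b v =>
       pullback1 (restr_coord G iota k a.2)
         (conn0 a.1 b.1 (h v + k b.2 - k a.2));
     conn1 := fun a => pullback2 (restr_coord G iota k a.2) (conn1 a.1) |}.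

(** Transition functions, in the coordinate of the first patch, with the
    convention psi_al = phi_{al be} psi_be. *)
Definition transitions V L (G : gerbe V L) :=
  gidx G -> gidx G -> L -> V -> R[i].

Definition id_twisted_line_bundle V L (G : gerbe V L) (phi : transitions G) :=
  (forall al be lam p, overlap al be lam p -> phi al be lam p != 0) /\
  (forall al be lam, csmooth_on (overlap al be lam) (phi al be lam)) /\
  (forall al be ga lam mu p,
     overlap al be lam p -> overlap be ga mu (p + gshift G lam) ->
     phi al be lam p * phi be ga mu (p + gshift G lam) = phi al ga (lam + mu) p).

(** The operators d + w_al satisfy
    nabla_be - phi^-1 nabla_al phi = (connection form of the gerbe). *)
Definition twisted_connection V L (G : gerbe V L) (phi : transitions G)
    (w : gidx G -> oneform V) : Prop :=
  (forall al, smooth_oneform_on (chart al) (w al)) /\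
  (forall al be lam p u, overlap al be lam p ->
     w be (p + gshift G lam) u
       - ((phi al be lam p)^-1 * cderive u (phi al be lam) p + w al p u)
     = conn0 al be lam p u).

Definition local_curvature V L (G : gerbe V L) (w : gidx G -> oneform V)
    (al : gidx G) : twoform V := dform (w al).

Definition curvature V L (G : gerbe V L) (w : gidx G -> oneform V)
    (al : gidx G) : twoform V :=
  fun p u v => local_curvature w al p u v - conn1 al p u v.

End Gerbes.

(** R^n x R^n, with coordinates (x, y), and its lattice Z^n x Z^n. *)
Definition plane (R : realType) (n : nat) : normedModType R :=
  ('cV[R]_n * 'cV[R]_n)%type.
Definition lattice (n : nat) : zmodType := ('cV[int]_n * 'cV[int]_n)%type.

Section Coordinates.
Context {R : realType} {n : nat}.
Local Notation plane := (plane R n).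
Local Notation lattice := (lattice n).

Definition intv (v : 'cV[int]_n) : 'cV[R]_n := map_mx intr v.
Definition intp (lam : lattice) : plane := (intv lam.1, intv lam.2).

Definition cmx m k (A : 'M[R]_(m, k)) : 'M[R[i]]_(m, k) := map_mx (real_complex R) A.
Definition Remx m k (A : 'M[R[i]]_(m, k)) : 'M[R]_(m, k) := map_mx (@complex.Re R) A.
Definition Immx m k (A : 'M[R[i]]_(m, k)) : 'M[R]_(m, k) := map_mx (@complex.Im R) A.

Definition dx (u : plane) : 'cV[R[i]]_n := cmx u.1.
Definition dy (u : plane) : 'cV[R[i]]_n := cmx u.2.

(** The 2-form f^t A g, for vectors f and g of constant 1-forms. *)
Definition wedge_mx (V : normedModType R) (f : V -> 'cV[R[i]]_n)
    (A : 'M[R[i]]_n) (g : V -> 'cV[R[i]]_n) : twoform V :=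
  fun _ u v => ((f u)^T *m A *m g v - (f v)^T *m A *m g u) 0 0.

Definition ipi : R[i] := 0 +i* pi.

(** The complex structure of the coordinates z = x + T y on R^n x R^n:
    multiplication by i, for Im T invertible. *)
Definition cplx_struct (T : 'M[R[i]]_n) (u : plane) : plane :=
  let v := invmx (Immx T) *m (u.1 + Remx T *m u.2) in
  (- (Immx T *m u.2) - Remx T *m v, v).

(** The (0,2)-part w (P u, P v), where P u = (u + i J u) / 2 is the projection
    to T^{0,1} and w is extended complex bilinearly. *)
Definition part02 (T : 'M[R[i]]_n) (w : twoform plane) : twoform plane :=
  fun p u v =>
    let J := cplx_struct T in
    (w p u v + 'i%C * w p (J u) v + 'i%C * w p u (J v) - w p (J u) (J v)) / 4%:R.

(** The boxes are indexed from 0 instead of 1. *)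
Definition in_box (eps : R) (l : {ffun 'I_n -> 'I_3}) (x : 'cV[R]_n) : Prop :=
  forall j, (l j)%:R / 3%:R - eps < x j 0 < (l j).+1%:R / 3%:R + eps.

Definition torus_gerbe (eps : R) (tau : 'M[R]_n) : gerbe plane lattice :=
  {| gidx := ({ffun 'I_n -> 'I_3} * {ffun 'I_n -> 'I_3})%type;
     gshift := intp;
     chart := fun lm => [set p | in_box eps lm.1 p.1 /\ in_box eps lm.2 p.2];
     conn0 := fun _ _ lam _ u =>
       - ipi * ((cmx (intv lam.1))^T *m cmx tau *m dx u) 0 0;
     conn1 := fun _ p u v => - ipi * wedge_mx dx (cmx tau) dx p u v |}.

End Coordinates.

Section ComplexSide.
Context {R : realType} {n : nat}.
Variables (T : 'M[R[i]]_n) (eps : R) (tau : 'M[R]_n).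

(** On the part of an overlap where x' = x + v, the relations on local sections
    read psi' = exp (2 pi i (a v)^t y) psi, so that phi is the inverse factor. *)
Definition E_transitions (a : 'M[int]_n) : transitions (torus_gerbe eps tau) :=
  fun _ _ lam p => expi (- (2%:R * pi * ((intv (a *m lam.1))^T *m p.2) 0 0)).

Definition E_connection (s : 'cV[R]_n -> 'cV[R]_n) (q : 'cV[R]_n) :
    gidx (torus_gerbe eps tau) -> oneform (plane R n) :=
  fun _ p u =>
    - (2%:R * ipi) * (((cmx (s p.1))^T + (cmx q)^T *m T) *m dy u) 0 0
    - ipi * ((cmx p.1)^T *m cmx tau *m dx u) 0 0.

Definition twisted_integrable_connection (phi : transitions (torus_gerbe eps tau))
    (w : gidx (torus_gerbe eps tau) -> oneform (plane R n)) : Prop :=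
  [/\ id_twisted_line_bundle phi, twisted_connection phi w &
      forall (al : gidx (torus_gerbe eps tau)) (p u v : plane R n),
        chart al p -> part02 T (curvature w al) p u v = 0].

End ComplexSide.

Section SymplecticSide.
Context {R : realType} {n : nat}.
Variables (T : 'M[R[i]]_n) (tau : 'M[R]_n).

Definition omega_mat : 'M[R]_n := Immx (- (invmx T)^T).
Definition B_mat : 'M[R]_n := Remx (- (invmx T)^T).

Definition mirror : complexified_symplectic (plane R n) :=
  {| sympl_form := fun p u v =>
       (2%:R * pi)%:C * wedge_mx dx (cmx omega_mat) dy p u v;
     B_field := fun p u v =>
       (2%:R * pi)%:C * wedge_mx dx (cmx B_mat) dy p u v
       + pi%:C * wedge_mx dx (cmx tau) dx p u v |}.

Definition tau_int : 'M[int]_n :=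
  \matrix_(i, j) if (i < j)%N then Num.floor (tau i j)
                 else if (j < i)%N then - Num.floor (tau j i) else 0.
Definition tau_intR : 'M[R]_n := map_mx intr tau_int.
Definition tau_frac : 'M[R]_n := tau - tau_intR.

Variables (eps : R) (s : 'cV[R]_n -> 'cV[R]_n) (a : 'M[int]_n).

Definition graph_map (x : 'cV[R]_n) : plane R n := (x, s x).

(** L_(s,a), as a lattice-invariant subset of R^n x R^n. *)
Definition graph_lagr : set (plane R n) :=
  [set p | exists x lam, p = graph_map x + intp lam].

(** The gerbe of tau_frac restricted to L_(s,a), in the coordinate x of the
    parametrization.  On the patch (al, w), the coordinates in the box al are
    (x, s x + w), so that x is also the first coordinate in the box;
    s (x + v) = s x + a v. *)
Definition y_shift (w : 'cV[int]_n) : lattice n := (0, w).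

Definition graph_gerbe : gerbe 'cV[R]_n 'cV[int]_n :=
  gerbe_restr (torus_gerbe eps tau_frac) intv graph_map
    (fun v => (v, a *m v) : lattice n) y_shift.

(** The inclusion of L_(s,a), from a patch of [graph_gerbe] to its box. *)
Definition graph_incl (c : gidx graph_gerbe) : 'cV[R]_n -> plane R n :=
  restr_coord (torus_gerbe eps tau_frac) graph_map y_shift c.2.

(** The relations on local sections give
    psi (x + v) = exp (pi i (v^t tau_int x + c v)) psi x, with
    c v = sum_(i < j) (tau_int)_ij v_i v_j; the term c v vanishes for v = e_i
    and makes the factors multiplicative in v. *)
Definition L_transitions : transitions graph_gerbe :=
  fun _ _ v x =>
    expi (- (pi * (((intv v)^T *m tau_intR *m x) 0 0
                   + (\sum_(i < n) \sum_(j < n | (i < j)%N)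
                        tau_int i j * v i 0 * v j 0)%:~R))).

Definition L_connection (q : 'cV[R]_n) : gidx graph_gerbe -> oneform 'cV[R]_n :=
  fun _ x u =>
    - ipi * ((cmx x)^T *m cmx tau_intR *m cmx u) 0 0
    - 2%:R * ipi * ((cmx q)^T *m cmx u) 0 0
    - ipi * ((cmx x)^T *m cmx tau_frac *m cmx u) 0 0.

End SymplecticSide.

Arguments E_transitions {R n} eps tau a.
Arguments E_connection {R n} T eps tau s q.
Arguments L_transitions {R n} tau eps s a.
Arguments L_connection {R n} tau eps s a q.
Arguments graph_incl {R n} tau eps s a c x.

(* Main.v *)
(** Both sides amount to the symmetry of one matrix.  Let [S] be the Jacobian
    matrix of [s] at [x].  The terms in [tau] cancel in the curvature of the
    bundle on the complex torus, which is [-2 pi i dx^t S^t dy]; vectors of type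
    (0,1) satisfy [dx = - T dy], so that the (0,2)-part vanishes if and only if
    [S T] is symmetric.  On the symplectic side, the tangent vectors of the graph
    are the pairs [(u, S u)], and the terms in [tau] cancel again: the two
    conditions say that the imaginary and the real part of [-(T^-1)^t S] are
    symmetric.  Finally [S T] is symmetric if and only if [(T^-1)^t S] is.  The
    boxes cover a fundamental domain and [S] is periodic, so a condition on all
    patches is a condition at every [x]. *)

Require Import Defs.
From mathcomp Require Import all_boot all_order all_algebra.
From mathcomp Require Import all_classical all_reals all_analysis.
From mathcomp Require Import complex.
From mathcomp Require Import ring lra.
Import Order.TTheory GRing.Theory Num.Theory.
Import numFieldNormedType.Exports.
Local Open Scope classical_set_scope.
Local Open Scope ring_scope.
Local Open Scope complex_scope.

(** * Differentials of linear and affine maps *)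

Section Differentials.
Context {R : realType}.
Implicit Types V W : normedModType R.

Lemma linear_cV_continuous {n : nat} {W} (f : {linear 'cV[R]_n -> W}) :
  continuous f.
Proof.
have -> : f = (fun x => \sum_(i < n) x i 0 *: f (delta_mx i 0)) :> (_ -> _).
  apply/funext => x; rewrite [x in LHS]matrix_sum_delta linear_sum.
  by apply: eq_bigr => i _; rewrite big_ord1 linearZ.
apply: continuous_big; first exact: add_continuous.
move=> i _ x; exact: cvgZr_tmp (@coord_continuous R n 1 i 0 x).
Qed.

Lemma is_diff_mulmx {m n : nat} (A : 'M[R]_(m, n)) (x : 'cV[R]_n) :
  is_diff x (mulmx A : 'cV_n -> 'cV_m) (mulmx A).
Proof.
split; first exact/linear_differentiable/linear_cV_continuous.
exact/diff_lin/linear_cV_continuous.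
Qed.

Lemma is_diff_coord {n : nat} (i : 'I_n) (x : 'cV[R]_n) :
  is_diff x (fun y : 'cV[R]_n => y i 0 : R) (fun y => y i 0).
Proof.
have @f : {linear 'cV[R]_n -> R}.
  by exists (fun N : 'cV[R]_n => N i 0); do 2![eexists]; do ?[constructor];
     rewrite ?mxE// => ? *; rewrite ?mxE//; move=> ?; rewrite !mxE.
rewrite (_ : (fun _ => _) = f) //; split.
  exact/linear_differentiable/linear_cV_continuous.
exact/diff_lin/linear_cV_continuous.
Qed.

(** The entry of a row-by-column product is the shape of every coefficient of the connection forms
    and of every phase of the transition functions. *)
Lemma is_diff_row {V} {n : nat} (A : 'rV[R]_n) {g dg : V -> 'cV[R]_n} {x : V} :
  is_diff x g dg ->
  is_diff x (fun p => (A *m g p) 0 0) (fun v => (A *m dg v) 0 0).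
Proof.
move=> gx; have Agx := is_diff_comp gx (is_diff_mulmx A (g x)).
exact: is_diff_comp Agx (is_diff_coord 0 _).
Qed.

Lemma is_diff_fst {V W} (x : V * W) : is_diff x (@fst V W) fst.
Proof.
split; first by apply: linear_differentiable => y; exact: cvg_fst.
by apply: diff_lin => y; exact: cvg_fst.
Qed.

Lemma is_diff_snd {V W} (x : V * W) : is_diff x (@snd V W) snd.
Proof.
split; first by apply: linear_differentiable => y; exact: cvg_snd.
by apply: diff_lin => y; exact: cvg_snd.
Qed.

Lemma is_diff_ext {V W} {f df : V -> W} (g dg : V -> W) {x : V} :
  is_diff x f df -> f =1 g -> df =1 dg -> is_diff x g dg.
Proof. by move=> fx /funext <- /funext <-. Qed.

Lemma is_diff_idfun {V} (x : V) : is_diff x idfun idfun.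
Proof. exact: is_diff_id. Qed.

Lemma is_diff_line {V} (x u : V) (t : R) :
  is_diff t (fun h => x + h *: u) (fun h => h *: u).
Proof.
have h1 : is_diff t (fun h : R => h *: u) (fun h => h *: u) := is_diff_scalel t u.
apply: is_diff_ext (is_diffD (is_diff_cst x t) h1) _ _ => //= h.
exact: add0r.
Qed.

Lemma is_diff_addr {V} (c x : V) : is_diff x (fun y => y + c) id.
Proof.
apply: is_diff_ext (is_diffD (is_diff_id x) (is_diff_cst c x)) _ _ => y //=.
exact: addr0.
Qed.

Lemma diffE_of {V W} {f df : V -> W} {x : V} : is_diff x f df -> 'd f x = df :> (V -> W).
Proof. by case. Qed.

Lemma differentiable_of {V W} {f df : V -> W} {x : V} :
  is_diff x f df -> differentiable f x.
Proof. by case. Qed.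

Lemma is_diff_derive {V W} {f df : V -> W} {x : V} (v : V) :
  is_diff x f df -> is_derive x v f (df v).
Proof.
move=> fx; have fd := differentiable_of fx.
split; first exact: diff_derivable.
by rewrite deriveE// (diffE_of fx).
Qed.

End Differentials.

(** * Smoothness, by classes of maps closed under directional derivatives *)

Section SmoothMaps.
Context {R : realType}.
Implicit Types V W : normedModType R.

(** [Ck_on] differentiates in the ambient space and uses the set only for pointwise conditions. Maps
    given by global formulas can therefore be treated on [setT] and then restricted to charts and
    overlaps. *)
Lemma smooth_on_subset {V W} (A B : set V) (f : V -> W) :
  A `<=` B -> smooth_on B f -> smooth_on A f.
Proof.
move=> AB fB k; elim: k f fB => [|k IH] f fB /=.
  by move=> x /AB; apply: (fB 0%N).
split=> [x /AB|v]; first exact: (fB 1%N).1.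
by apply: IH => m; apply: (fB m.+1).2.
Qed.

Lemma smooth_differentiable {V W} {f : V -> W} : smooth_on setT f ->
  forall x, differentiable f x.
Proof. by move=> /(_ 1%N) [+ _] x; apply. Qed.

Lemma smooth_derive {V W} {f : V -> W} (v : V) : smooth_on setT f ->
  smooth_on setT (fun x => 'D_v f x).
Proof. by move=> fs k; apply: (fs k.+1).2. Qed.

Lemma smooth_is_diff {V W} {f : V -> W} x : smooth_on setT f ->
  is_diff x f (fun v => 'D_v f x).
Proof.
move=> /smooth_differentiable fd; apply: (@is_diff_eq _ _ _ _ ('d f x)).
  exact/differentiableP.
by apply/funext => v; rewrite deriveE.
Qed.

(** A derivative of [x |-> f x + g x], say, has this form again, but for other
    [f] and [g]: smoothness is proved for a whole class of maps at once. *)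
Lemma smooth_coind {V W} (P : (V -> W) -> Prop) :
  (forall f, P f -> (forall x, differentiable f x) /\
                    forall v, P (fun x => 'D_v f x)) ->
  forall f, P f -> smooth_on setT f.
Proof.
move=> HP f Pf k; elim: k f Pf => [|k IH] f /HP [fd Pfd] /=.
  by move=> x _; apply: differentiable_continuous.
by split=> // v; apply: IH.
Qed.

Lemma smooth_coind_diff {V W} (P : (V -> W) -> Prop) :
  (forall f, P f -> exists2 df : V -> V -> W, (forall x, is_diff x f (df x)) &
                    forall v, P (fun x => df x v)) ->
  forall f, P f -> smooth_on setT f.
Proof.
move=> HP; apply: smooth_coind => f /HP [df fdf Pdf].
split=> [x|v]; first exact: differentiable_of (fdf x).
rewrite (_ : (fun x => _) = (fun x => df x v))//; apply/funext => x.
by have [_ ->] := is_diff_derive v (fdf x).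
Qed.

Lemma smooth_cst {V W} (c : W) : smooth_on [set: V] (fun _ => c).
Proof.
apply: (@smooth_coind_diff _ _ (fun f => exists c, f = cst c)); last by exists c.
move=> _ [d ->]; exists (fun _ _ => 0) => [x|v]; last by exists 0.
exact: is_diff_cst.
Qed.

(** Since [df] does not depend on the point, every directional derivative of [f] is constant. *)
Lemma smooth_affine {V W} {f df : V -> W} :
  (forall x, is_diff x f df) -> smooth_on setT f.
Proof.
move=> fdf [|k].
  by move=> x _; apply: differentiable_continuous; exact: differentiable_of (fdf x).
split=> [x _|v]; first exact: differentiable_of (fdf x).
rewrite (_ : (fun x => _) = (fun=> df v)); first exact: smooth_cst.
by apply/funext => x; have [_ ->] := is_diff_derive v (fdf x).
Qed.

Lemma smooth_id {V} : smooth_on [set: V] idfun.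
Proof. exact: smooth_affine is_diff_idfun. Qed.

Lemma smoothD {V W} {f g : V -> W} : smooth_on setT f -> smooth_on setT g ->
  smooth_on setT (fun x => f x + g x).
Proof.
move=> fs gs; apply: (@smooth_coind_diff _ _ (fun h => exists f g : V -> W,
  [/\ smooth_on setT f, smooth_on setT g & h = (fun x => f x + g x)]));
  last by exists f, g.
move=> _ [{fs gs}f [{}g [fs gs ->]]].
exists (fun x v => 'D_v f x + 'D_v g x) => [x|v].
  exact: is_diffD (smooth_is_diff x fs) (smooth_is_diff x gs).
by exists (fun x => 'D_v f x), (fun x => 'D_v g x); split=> //; exact: smooth_derive.
Qed.

Lemma smoothZ {V W} {f : V -> W} (c : R) : smooth_on setT f ->
  smooth_on setT (fun x => c *: f x).
Proof.
move=> fs; apply: (@smooth_coind_diff _ _ (fun h => exists2 f : V -> W,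
  smooth_on setT f & h = (fun x => c *: f x))); last by exists f.
move=> _ [{fs}f fs ->].
exists (fun x v => c *: 'D_v f x) => [x|v].
  exact: is_diffZ (smooth_is_diff x fs).
by exists (fun x => 'D_v f x) => //; exact: smooth_derive.
Qed.

Lemma smooth_pair {U V W : normedModType R} {f : U -> V} {g : U -> W} :
  smooth_on setT f -> smooth_on setT g -> smooth_on setT (fun x => (f x, g x)).
Proof.
move=> fs gs; apply: (@smooth_coind_diff _ _ (fun h => exists (f : U -> V) (g : U -> W),
  [/\ smooth_on setT f, smooth_on setT g & h = (fun x => (f x, g x))]));
  last by exists f, g.
move=> _ [{fs gs}f [{}g [fs gs ->]]].
exists (fun x v => ('D_v f x, 'D_v g x)) => [x|v].
  exact: is_diff_pair (smooth_is_diff x fs) (smooth_is_diff x gs).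
by exists (fun x => 'D_v f x), (fun x => 'D_v g x); split=> //; exact: smooth_derive.
Qed.

Lemma smooth_row {V} {n : nat} (A : 'rV[R]_n) {f : V -> 'cV[R]_n} :
  smooth_on setT f -> smooth_on setT (fun x => (A *m f x) 0 0 : R).
Proof.
move=> fs; apply: (@smooth_coind_diff _ _ (fun h => exists2 f : V -> 'cV[R]_n,
  smooth_on setT f & h = (fun x => (A *m f x) 0 0))); last by exists f.
move=> _ [{fs}f fs ->].
exists (fun x v => (A *m 'D_v f x) 0 0) => [x|v].
  exact: is_diff_row (smooth_is_diff x fs).
by exists (fun x => 'D_v f x) => //; exact: smooth_derive.
Qed.

(** The derivative of [f \o l] along [v] is the derivative of [f] along the constant vector [dl v],
    composed with the same [l]; so the maps [f \o l] with [l] fixed form a class closed under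
    derivatives. *)
Lemma smooth_comp_affine {U V W : normedModType R} {l dl : U -> V} {f : V -> W} :
  (forall x, is_diff x l dl) -> smooth_on setT f -> smooth_on setT (fun x => f (l x)).
Proof.
move=> ll fs; apply: (@smooth_coind_diff _ _ (fun h => exists2 f : V -> W,
  smooth_on setT f & h = (fun x => f (l x)))); last by exists f.
move=> _ [{fs}f fs ->].
exists (fun x v => 'D_(dl v) f (l x)) => [x|v].
  exact: is_diff_comp (ll x) (smooth_is_diff (l x) fs).
by exists (fun x => 'D_(dl v) f x) => //; exact: smooth_derive.
Qed.

Lemma is_diff_cos (t : R) : is_diff t (@cos R) (fun h => - sin t * h).
Proof.
have [c1 c2] := is_derive_cos t; split; first exact/derivable1_diffP.
by apply/funext => h; rewrite deriv1E// /= derive1E c2 /GRing.scale /= mulrC.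
Qed.

Lemma is_diff_sin (t : R) : is_diff t (@sin R) (fun h => cos t * h).
Proof.
have [c1 c2] := is_derive_sin t; split; first exact/derivable1_diffP.
by apply/funext => h; rewrite deriv1E// /= derive1E c2 /GRing.scale /= mulrC.
Qed.

(** The span of [cos] and [sin] is closed under derivatives, which neither function is alone. *)
Lemma smooth_cos_sin (b c : R) : smooth_on [set: R] (fun t => b * cos t + c * sin t).
Proof.
apply: (@smooth_coind_diff _ _ (fun h => exists b c,
  h = (fun t => b * cos t + c * sin t))); last by exists b, c.
move=> _ [{}b [{}c ->]].
exists (fun t v => b *: (- sin t * v) + c *: (cos t * v)) => [t|v].
  exact: is_diffD (is_diffZ _ (is_diff_cos t)) (is_diffZ _ (is_diff_sin t)).
exists (c * v), (- b * v); apply/funext => t.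
by rewrite /GRing.scale /=; ring.
Qed.

End SmoothMaps.

(** * Calculus of complex-valued functions, and the character [expi] *)

Section ComplexValued.
Context {R : realType}.
Implicit Types V : normedModType R.

Lemma Re_add (x y : R[i]) : complex.Re (x + y) = complex.Re x + complex.Re y.
Proof. by case: x y => [? ?] [? ?]. Qed.

Lemma Im_add (x y : R[i]) : complex.Im (x + y) = complex.Im x + complex.Im y.
Proof. by case: x y => [? ?] [? ?]. Qed.

Lemma Re_mul (x y : R[i]) :
  complex.Re (x * y) = complex.Re x * complex.Re y - complex.Im x * complex.Im y.
Proof. by case: x y => [? ?] [? ?]. Qed.

Lemma Im_mul (x y : R[i]) :
  complex.Im (x * y) = complex.Re x * complex.Im y + complex.Im x * complex.Re y.
Proof. by case: x y => [? ?] [? ?] /=. Qed.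

Definition is_cdiff {V} (x : V) (f df : V -> R[i]) : Prop :=
  is_diff x (fun p => complex.Re (f p)) (fun v => complex.Re (df v)) /\
  is_diff x (fun p => complex.Im (f p)) (fun v => complex.Im (df v)).

Lemma cderiveE {V} {x : V} {f df : V -> R[i]} (v : V) :
  is_cdiff x f df -> cderive v f x = df v.
Proof.
move=> [/(is_diff_derive v)[_ reE] /(is_diff_derive v)[_ imE]].
by rewrite /cderive reE imE; case: (df v).
Qed.

Lemma is_cdiff_cst {V} (x : V) (c : R[i]) : is_cdiff x (fun=> c) (fun=> 0).
Proof. by split; exact: is_diff_cst. Qed.

Lemma is_cdiff_real {V} {x : V} {f df : V -> R} :
  is_diff x f df -> is_cdiff x (fun p => (f p)%:C) (fun v => (df v)%:C).
Proof. by move=> fx; split=> //=; exact: is_diff_cst. Qed.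

Lemma is_cdiffD {V} {x : V} {f df g dg : V -> R[i]} :
  is_cdiff x f df -> is_cdiff x g dg ->
  is_cdiff x (fun p => f p + g p) (fun v => df v + dg v).
Proof.
move=> [f1 f2] [g1 g2]; split.
  by apply: is_diff_ext (is_diffD f1 g1) _ _ => p; rewrite Re_add.
by apply: is_diff_ext (is_diffD f2 g2) _ _ => p; rewrite Im_add.
Qed.

Lemma is_cdiffM {V} {x : V} {f df : V -> R[i]} (c : R[i]) :
  is_cdiff x f df -> is_cdiff x (fun p => c * f p) (fun v => c * df v).
Proof.
move=> [f1 f2]; split.
  apply: is_diff_ext
    (is_diffB (is_diffZ (complex.Re c) f1) (is_diffZ (complex.Im c) f2)) _ _;
  by move=> p; rewrite Re_mul.
apply: is_diff_ext
    (is_diffD (is_diffZ (complex.Re c) f2) (is_diffZ (complex.Im c) f1)) _ _;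
by move=> p; rewrite Im_mul.
Qed.

Lemma is_cdiff_expi {V} {x : V} {f df : V -> R} : is_diff x f df ->
  is_cdiff x (fun p => expi (f p)) (fun v => 'i%C * (df v)%:C * expi (f x)).
Proof.
move=> fx; split.
  apply: is_diff_ext (is_diff_comp fx (is_diff_cos (f x))) _ _ => // v.
  by rewrite !Re_mul Im_mul /=; ring.
apply: is_diff_ext (is_diff_comp fx (is_diff_sin (f x))) _ _ => // v.
by rewrite !Im_mul !Re_mul /=; ring.
Qed.

Lemma csmooth_on_subset {V} (A B : set V) (f : V -> R[i]) :
  A `<=` B -> csmooth_on B f -> csmooth_on A f.
Proof.
by move=> AB [f1 f2]; split; [exact: smooth_on_subset f1 | exact: smooth_on_subset f2].
Qed.

Lemma csmooth_cst {V} (c : R[i]) : csmooth_on [set: V] (fun=> c).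
Proof. by split; exact: smooth_cst. Qed.

Lemma csmooth_real {V} {f : V -> R} :
  smooth_on setT f -> csmooth_on setT (fun p => (f p)%:C).
Proof. by move=> fs; split=> //=; exact: smooth_cst. Qed.

Lemma csmoothD {V} {f g : V -> R[i]} : csmooth_on setT f -> csmooth_on setT g ->
  csmooth_on setT (fun p => f p + g p).
Proof.
move=> [f1 f2] [g1 g2]; split.
  by under eq_fun do rewrite Re_add; exact: smoothD.
by under eq_fun do rewrite Im_add; exact: smoothD.
Qed.

Lemma csmoothM {V} {f : V -> R[i]} (c : R[i]) : csmooth_on setT f ->
  csmooth_on setT (fun p => c * f p).
Proof.
move=> [f1 f2]; split.
  under eq_fun do rewrite Re_mul -mulNr.
  exact: smoothD (smoothZ _ f1) (smoothZ _ f2).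
under eq_fun do rewrite Im_mul.
exact: smoothD (smoothZ _ f2) (smoothZ _ f1).
Qed.

Lemma csmooth_expi {V} {f df : V -> R} :
  (forall x, is_diff x f df) -> csmooth_on setT (fun p => expi (f p)).
Proof.
move=> fl; split.
  have := smooth_comp_affine fl (smooth_cos_sin 1 0).
  by under eq_fun do rewrite mul1r mul0r addr0.
have := smooth_comp_affine fl (smooth_cos_sin 0 1).
by under eq_fun do rewrite mul0r mul1r add0r.
Qed.

Lemma expiD (t u : R) : expi (t + u) = expi t * expi u.
Proof.
apply/eqP; rewrite eq_complex Re_mul Im_mul /= cosD sinD.
by rewrite eqxx /= addrC.
Qed.

Lemma expi0 : expi 0 = 1 :> R[i].
Proof. by rewrite /expi cos0 sin0. Qed.

Lemma expi_neq0 (t : R) : expi t != 0.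
Proof.
apply/eqP => t0; have := oner_neq0 R[i].
by rewrite -expi0 -(subrr t) expiD t0 mul0r eqxx.
Qed.

(** This is what absorbs the integer discrepancies in the cocycle conditions of both line
    bundles. *)
Lemma expi_2pi_int (m : int) : expi (2%:R * pi * m%:~R) = 1 :> R[i].
Proof.
have nat_case (k : nat) : expi (2%:R * pi * k%:R) = 1 :> R[i].
  have -> : 2%:R * pi * k%:R = 0 + pi *+ 2 *+ k :> R.
    by rewrite add0r mulrC -[in RHS]mulr_natr -(mulr_natr pi); ring.
  rewrite /expi (periodicn (@cosD2pi R)) (periodicn (@sinD2pi R)).
  by rewrite cos0 sin0.
case: m => k; first exact: nat_case.
rewrite NegzE mulrNz mulrN; apply: (mulIf (expi_neq0 (2%:R * pi * k.+1%:R))).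
by rewrite -expiD addNr expi0 mul1r nat_case.
Qed.

End ComplexValued.

(** * Bilinear forms given by matrices *)

Section MatrixForms.
Context {K : comNzRingType} {n : nat}.
Implicit Types (A B : 'M[K]_n) (x y z : 'cV[K]_n) (c : K).

Definition bilin A x y : K := (x^T *m A *m y) 0 0.

Definition dotv {m : nat} (x y : 'cV[K]_m) : K := (x^T *m y) 0 0.

Lemma dotvC x y : dotv x y = dotv y x.
Proof.
have -> : dotv y x = (y^T *m x)^T 0 0 by rewrite mxE.
by rewrite trmx_mul trmxK.
Qed.

Lemma dotvDr x y z : dotv x (y + z) = dotv x y + dotv x z.
Proof. by rewrite /dotv mulmxDr mxE. Qed.

Lemma dotvZr c x y : dotv x (c *: y) = c * dotv x y.
Proof. by rewrite /dotv -scalemxAr mxE. Qed.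

Lemma bilinE A x y : bilin A x y = dotv x (A *m y).
Proof. by rewrite /bilin /dotv mulmxA. Qed.

Lemma bilinDl A x y z : bilin A (x + y) z = bilin A x z + bilin A y z.
Proof. by rewrite /bilin linearD !mulmxDl mxE. Qed.

Lemma bilinDr A x y z : bilin A x (y + z) = bilin A x y + bilin A x z.
Proof. by rewrite /bilin mulmxDr mxE. Qed.

Lemma bilinZl A c x y : bilin A (c *: x) y = c * bilin A x y.
Proof. by rewrite /bilin linearZ -!scalemxAl mxE. Qed.

Lemma bilinZr A c x y : bilin A x (c *: y) = c * bilin A x y.
Proof. by rewrite /bilin -scalemxAr mxE. Qed.

Lemma bilinNl A x y : bilin A (- x) y = - bilin A x y.
Proof. by rewrite -scaleN1r bilinZl mulN1r. Qed.

(** With [c] the imaginary unit and [x'], [y'] the images of [x], [y] under the complex structure,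
    the right-hand side is the combination that occurs in [part02]. *)
Lemma bilin_sqrtN1 A {c} x x' y y' : c * c = -1 ->
  bilin A (x + c *: x') (y + c *: y') =
  bilin A x y + c * bilin A x' y + c * bilin A x y' - bilin A x' y'.
Proof.
move=> cc; rewrite bilinDl !bilinDr !bilinZl !bilinZr.
by rewrite mulrA cc mulN1r addrACA !addrA.
Qed.

Lemma bilin_mulmxl A B x y : bilin A (B *m x) y = bilin (B^T *m A) x y.
Proof. by rewrite /bilin trmx_mul -!mulmxA. Qed.

Lemma bilin_mulmxr A B x y : bilin A x (B *m y) = bilin (A *m B) x y.
Proof. by rewrite /bilin !mulmxA. Qed.

Lemma bilin_mxD A B x y : bilin (A + B) x y = bilin A x y + bilin B x y.
Proof. by rewrite /bilin mulmxDr mulmxDl mxE. Qed.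

Lemma bilin_tr A x y : bilin A^T x y = bilin A y x.
Proof.
have -> : bilin A y x = (y^T *m A *m x)^T 0 0 by rewrite mxE.
by rewrite !trmx_mul trmxK mulmxA.
Qed.

Lemma bilin_delta A i j : bilin A (delta_mx i 0) (delta_mx j 0) = A i j.
Proof. by rewrite /bilin trmx_delta -rowE -colE !mxE. Qed.

Lemma bilin_symP A :
  (forall x y, bilin A x y = bilin A y x) <-> A^T = A.
Proof.
split=> [Asym|Asym x y]; last by rewrite -bilin_tr Asym.
by apply/matrixP => i j; rewrite mxE -!bilin_delta.
Qed.

End MatrixForms.

(** * Real and imaginary parts of matrices, and the (0,2)-part of the curvature *)

Section ComplexMatrices.
Context {R : realType} {n : nat}.

Lemma cmxD m k (A B : 'M[R]_(m, k)) : cmx (A + B) = cmx A + cmx B.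
Proof. exact: map_mxD. Qed.

Lemma cmxM m k l (A : 'M[R]_(m, k)) (B : 'M[R]_(k, l)) :
  cmx (A *m B) = cmx A *m cmx B.
Proof. exact: map_mxM. Qed.

Lemma cmxN m k (A : 'M[R]_(m, k)) : cmx (- A) = - cmx A.
Proof. exact: map_mxN. Qed.

Lemma cmx_tr m k (A : 'M[R]_(m, k)) : cmx A^T = (cmx A)^T.
Proof. by rewrite /cmx map_trmx. Qed.

Lemma cmxZ m k c (A : 'M[R]_(m, k)) : cmx (c *: A) = c%:C *: cmx A.
Proof. exact: map_mxZ. Qed.

Lemma bilin_cmx (A : 'M[R]_n) x y : bilin (cmx A) (cmx x) (cmx y) = (bilin A x y)%:C.
Proof. by rewrite /bilin -cmx_tr -!cmxM mxE. Qed.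

Lemma dotv_cmx (x y : 'cV[R]_n) : dotv (cmx x) (cmx y) = (dotv x y)%:C.
Proof. by rewrite /dotv -cmx_tr -cmxM mxE. Qed.

Lemma cmx_Re_Im m k (A : 'M[R[i]]_(m, k)) : A = cmx (Remx A) + 'i%C *: cmx (Immx A).
Proof. by apply/matrixP => i j; rewrite !mxE -complexE. Qed.

Lemma cmx_Re_Im_inj m k (A B A' B' : 'M[R]_(m, k)) :
  cmx A + 'i%C *: cmx B = cmx A' + 'i%C *: cmx B' -> A = A' /\ B = B'.
Proof.
move=> /matrixP AB; split; apply/matrixP => i j; have := AB i j; rewrite !mxE.
  move=> /(congr1 (@complex.Re R)).
  by rewrite !Re_add !Re_mul /= !mul0r !mul1r !subr0 !addr0.
by move=> /(congr1 (@complex.Im R)); rewrite !Im_add !Im_mul /= !mul0r !mul1r !add0r.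
Qed.

(** A nonzero row [r] with [r *m Y = 0] would give the value 0 to the form at [r^T]. *)
Lemma pos_unitmx (Y : 'M[R]_n) :
  (forall x : 'cV[R]_n, x != 0 -> 0 < bilin Y x x) -> Y \in unitmx.
Proof.
move=> Ypos; rewrite -row_free_unit -kermx_eq0; apply/eqP/row_matrixP => i.
rewrite row0; apply/eqP/negP => /negP r0.
have : (row i (kermx Y))^T != 0 by rewrite -trmx0 (inj_eq trmx_inj).
move=> /Ypos; rewrite /bilin trmxK -row_mul mulmx_ker.
by rewrite row0 mul0mx mxE ltxx.
Qed.

(** Symmetry is preserved by congruence, and [(invmx T)^T *m (S *m T) *m invmx T = (invmx T)^T *m
    S]. *)
Lemma sym_mul_invmx (T S : 'M[R[i]]_n) : T \in unitmx ->
  (S *m T)^T = S *m T <-> (- (invmx T)^T *m S)^T = - (invmx T)^T *m S.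
Proof.
move=> Tu; rewrite mulNmx linearN /= !trmx_mul trmxK.
have WT : (invmx T)^T *m T^T = 1%:M by rewrite -trmx_mul mulmxV// trmx1.
have TW : T^T *m (invmx T)^T = 1%:M by rewrite -trmx_mul mulVmx// trmx1.
split=> [ST|/oppr_inj ST].
  by rewrite -[S in RHS](mulmxK Tu) -ST !mulmxA WT mul1mx.
by rewrite -[S in RHS]mul1mx -TW -(mulmxA T^T) -ST -!mulmxA mulVmx// mulmx1.
Qed.

(** As [S] is real, the real and imaginary parts of [- (invmx T)^T *m S] are [B_mat T *m S] and
    [omega_mat T *m S], and symmetry can be tested on each part. *)
Lemma mirror_symP (T : 'M[R[i]]_n) (S : 'M[R]_n) : T \in unitmx ->
  (cmx S *m T)^T = cmx S *m T <->
  (omega_mat T *m S)^T = omega_mat T *m S /\ (B_mat T *m S)^T = B_mat T *m S.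
Proof.
move=> Tu; rewrite (sym_mul_invmx _ _ Tu).
rewrite [- _](cmx_Re_Im _ _ (- (invmx T)^T)) -/(B_mat T) -/(omega_mat T).
rewrite mulmxDl -scalemxAl -!cmxM linearD linearZ /= -!cmx_tr.
by split=> [/cmx_Re_Im_inj[-> ->] | [-> ->]].
Qed.

(** The vector [u + i J u] is of type (0,1), so [dz = dx + T dy] vanishes on it. *)
Lemma cplx_struct01 (T : 'M[R[i]]_n) (u : plane R n) : Immx T \in unitmx ->
  cmx u.1 + 'i%C *: cmx (cplx_struct T u).1 =
  - (T *m (cmx u.2 + 'i%C *: cmx (cplx_struct T u).2)).
Proof.
move=> Yu; rewrite /cplx_struct /=; set v := invmx _ *m _.
(* Eliminating [u.1] in favour of [v], the [y]-component of [J u], leaves an identity in the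
   independent vectors [v] and [u.2]. *)
have -> : u.1 = Immx T *m v - Remx T *m u.2 by rewrite mulKVmx// addrK.
clearbody v.
rewrite [T in RHS](cmx_Re_Im _ _ T) !mulmxDl !mulmxDr !cmxD !cmxN !cmxM.
rewrite -!scalemxAl -!scalemxAr !scalerA -expr2 sqr_i scaleN1r.
move: (cmx (Immx T) *m cmx v) (cmx (Remx T) *m cmx v) => a b.
move: (cmx (Immx T) *m cmx u.2) (cmx (Remx T) *m cmx u.2) => c d.
by rewrite scalerBr scalerN !opprD opprK addrACA [RHS]addrC [- _ + a]addrC.
Qed.

(** The form [c dx^t S^t dy]; with [S] the Jacobian of [s] and [c = - 2 pi i] it is the curvature of
    the bundle on the complex torus. *)
Definition curv_form (S : 'M[R]_n) (c : R[i]) : twoform (plane R n) := fun _ u v =>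
  c * (bilin (cmx S)^T (cmx u.1) (cmx v.2) - bilin (cmx S)^T (cmx v.1) (cmx u.2)).

(** Here [xi w] is the [y]-component of [w + i J w]. Replacing [dx] by [- T dy] on such vectors
    turns [S^t] into the form of [S *m T], and the 4 comes from the two projections
    [(w + i J w) / 2]. *)
Lemma part02_curv_form (T : 'M[R[i]]_n) (S : 'M[R]_n) c p u v :
  Immx T \in unitmx ->
  let xi (w : plane R n) := cmx w.2 + 'i%C *: cmx (cplx_struct T w).2 in
  part02 T (curv_form S c) p u v =
  c / 4%:R * (bilin (cmx S *m T) (xi u) (xi v) - bilin (cmx S *m T) (xi v) (xi u)).
Proof.
move=> Yu xi; rewrite -!(bilin_tr (cmx S *m T)) trmx_mul -!bilin_mulmxl.
pose b := bilin (cmx S)^T.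
have ii : 'i%C * 'i%C = -1 :> R[i] by rewrite -expr2 sqr_i.
have key (w w' : plane R n) : b (T *m xi w) (xi w') =
    - (b (cmx w.1) (cmx w'.2) + 'i%C * b (cmx (cplx_struct T w).1) (cmx w'.2)
       + 'i%C * b (cmx w.1) (cmx (cplx_struct T w').2)
       - b (cmx (cplx_struct T w).1) (cmx (cplx_struct T w').2)).
  by rewrite -[T *m _]opprK -cplx_struct01// /b bilinNl bilin_sqrtN1.
rewrite -/b (key u v) (key v u) /part02 /curv_form -/b.
move: 'i%C => I; do 8!(move: (b _ _) => ?).
by field.
Qed.

(** The (0,2)-part is the antisymmetrization of [S *m T] evaluated on vectors [xi w], and these
    include a basis. *)
Lemma part02_eq0P (T : 'M[R[i]]_n) (S : 'M[R]_n) (c : R[i]) p :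
  Immx T \in unitmx -> c != 0 ->
  (forall u v, part02 T (curv_form S c) p u v = 0) <->
  (cmx S *m T)^T = cmx S *m T.
Proof.
move=> Yu c0; split=> [H|/bilin_symP H u v]; last first.
  by rewrite part02_curv_form//= H subrr mulr0.
apply/matrixP => i j; rewrite mxE -!bilin_delta.
(* the [y]-component of [e k + i J (e k)] is the k-th basis vector *)
pose e (k : 'I_n) : plane R n := (- (Remx T *m delta_mx k 0), delta_mx k 0).
have := H (e i) (e j); rewrite part02_curv_form//=.
rewrite !addNr !mulmx0 /cmx !map_mx0 !scaler0 !addr0 !map_delta_mx.
move=> /eqP; rewrite mulf_eq0 subr_eq0 => /orP[|/eqP->//].
by rewrite mulf_eq0 (negPf c0) invr_eq0 pnatr_eq0.
Qed.

End ComplexMatrices.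

(** * Periodicity under the lattice, and the covering by boxes *)

Section LatticePeriodicity.
Context {R : realType} {n : nat}.
Implicit Types (x : 'cV[R]_n) (v w : 'cV[int]_n).

Lemma intvD v w : intv (v + w) = intv v + intv w :> 'cV[R]_n.
Proof. exact: map_mxD. Qed.

Lemma intvN v : intv (- v) = - intv v :> 'cV[R]_n.
Proof. exact: map_mxN. Qed.

Lemma intvB v w : intv (v - w) = intv v - intv w :> 'cV[R]_n.
Proof. exact: map_mxB. Qed.

Lemma intv0 : intv 0 = 0 :> 'cV[R]_n.
Proof. exact: map_mx0. Qed.

Lemma dotv_intv v w : dotv (intv v : 'cV[R]_n) (intv w) = (dotv v w)%:~R.
Proof. by rewrite /dotv /intv map_trmx -map_mxM mxE. Qed.

(** The [v] that satisfy the law form a subgroup of the lattice, and the hypothesis puts the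
    standard basis in it. *)
Lemma quasi_periodic_intv (a : 'M[int]_n) (s : 'cV[R]_n -> 'cV[R]_n) :
  (forall x j, s (x + delta_mx j 0) = s x + intv (col j a)) ->
  forall x v, s (x + intv v) = s x + intv (a *m v).
Proof.
move=> s_shift.
pose P v := forall x, s (x + intv v) = s x + intv (a *m v).
have PD v w : P v -> P w -> P (v + w).
  by move=> Pv Pw x; rewrite intvD addrA Pw Pv mulmxDr intvD addrA.
have PN v : P v -> P (- v).
  move=> Pv x; have := Pv (x - intv v).
  by rewrite subrK mulmxN !intvN => ->; rewrite addrK.
have P0 : P 0 by move=> x; rewrite mulmx0 intv0 !addr0.
have Pe j : P (delta_mx j 0).
  by move=> x; rewrite -colE /intv map_delta_mx s_shift.
have PMn v k : P v -> P (v *+ k).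
  by move=> Pv; elim: k => [|k IH]; rewrite ?mulr0n// mulrS; apply: PD.
have PZ v (m : int) : P v -> P (v *~ m).
  by case: m => k Pv; [exact: PMn | apply: PN; exact: PMn].
suff Pv v : P v by move=> x v; exact: Pv.
rewrite [v]matrix_sum_delta; elim/big_ind: _ => // i _.
by rewrite big_ord1 -[v i 0]intz scaler_int; exact: PZ.
Qed.

Lemma mulmx_inj_cV {K : comNzRingType} (A B : 'M[K]_n) :
  (forall u : 'cV[K]_n, A *m u = B *m u) -> A = B.
Proof.
move=> AB; apply/matrixP => i j; have := congr1 (dotv (delta_mx i 0)) (AB (delta_mx j 0)).
by rewrite -!bilinE !bilin_delta.
Qed.

Definition jac (s : 'cV[R]_n -> 'cV[R]_n) x : 'M[R]_n :=
  \matrix_(i, j) ('d s x (delta_mx j 0)) i 0.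

Lemma jacE (s : 'cV[R]_n -> 'cV[R]_n) x u : 'd s x u = jac s x *m u.
Proof.
rewrite [u in LHS]matrix_sum_delta linear_sum; apply/matrixP => i k.
rewrite summxE !mxE (ord1 k); apply: eq_bigr => j _.
by rewrite big_ord1 linearZ !mxE mulrC.
Qed.

Lemma is_diff_jac {s : 'cV[R]_n -> 'cV[R]_n} x :
  smooth_on setT s -> is_diff x s (mulmx (jac s x)).
Proof.
move=> /smooth_differentiable/(_ x)/differentiableP sd.
by apply: is_diff_ext sd _ _ => // u; rewrite jacE.
Qed.

(** Translating the argument by [intv v] changes [s] by a constant only, which differentiation
    removes. *)
Lemma jac_periodic (a : 'M[int]_n) (s : 'cV[R]_n -> 'cV[R]_n) :
  smooth_on setT s ->
  (forall x v, s (x + intv v) = s x + intv (a *m v)) ->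
  forall x v, jac s (x + intv v) = jac s x.
Proof.
move=> s_smooth s_shift x v.
have d1 := is_diff_comp (is_diff_addr (intv v) x) (is_diff_jac (x + intv v) s_smooth).
have d2 := is_diff_comp (is_diff_jac x s_smooth) (is_diff_addr (intv (a *m v)) (s x)).
have s_eq : s \o (fun y => y + intv v) = (fun y => y + intv (a *m v)) \o s.
  by apply/funext => y /=.
rewrite s_eq in d1.
have dE (u : 'cV[R]_n) : jac s (x + intv v) *m u = jac s x *m u.
  exact: etrans (esym (congr1 (@^~ u) (diffE_of d1))) (congr1 (@^~ u) (diffE_of d2)).
exact: mulmx_inj_cV dE.
Qed.

(** The thirds of the unit interval cover it; [eps] makes the inequalities strict at their
    endpoints. *)
Lemma in_box_cover (eps : R) x : 0 < eps -> (forall j, 0 <= x j 0 < 1) ->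
  exists l, in_box eps l x.
Proof.
move=> eps0 x01.
exists [ffun j => if x j 0 < 3^-1 then inord 0
                  else if x j 0 < 2 / 3 then inord 1 else inord 2].
move=> j; rewrite ffunE; have /andP[x0 x1] := x01 j.
case: (ltP (x j 0) 3^-1) => h1; first by rewrite inordK//; apply/andP; split; lra.
by case: (ltP (x j 0) (2 / 3)) => h2; rewrite inordK//; apply/andP; split; lra.
Qed.

Lemma floor_shift x : exists v, forall j, 0 <= (x + intv v) j 0 < 1.
Proof.
exists (\col_j - Num.floor (x j 0)) => j; rewrite !mxE mulrNz.
have /andP[] := floor_itv (x j 0); rewrite intrD => h1 h2.
by apply/andP; split; lra.
Qed.

End LatticePeriodicity.

(** * The twisted line bundle on the complex torus *)

Section ComplexLineBundle.
Context {R : realType} {n : nat}.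
Context (T : 'M[R[i]]_n) (eps : R) (tau : 'M[R]_n) (a : 'M[int]_n).
Context (s : 'cV[R]_n -> 'cV[R]_n) (q : 'cV[R]_n).

Lemma dx_linear c (u v : plane R n) : dx (c *: u + v) = c%:C *: dx u + dx v.
Proof. by rewrite /dx -cmxZ -cmxD. Qed.

Lemma dy_linear c (u v : plane R n) : dy (c *: u + v) = c%:C *: dy u + dy v.
Proof. by rewrite /dy -cmxZ -cmxD. Qed.

Lemma mulmx_row_linear (A : 'rV[R[i]]_n) c (u v : 'cV[R[i]]_n) :
  (A *m (c *: u + v)) 0 0 = c * (A *m u) 0 0 + (A *m v) 0 0.
Proof. by rewrite mulmxDr -scalemxAr mxE [X in X + _]mxE. Qed.

Lemma wedge_dxdx (A : 'M[R]_n) (p u v : plane R n) :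
  wedge_mx dx (cmx A) dx p u v = (bilin A u.1 v.1 - bilin A v.1 u.1)%:C.
Proof. by rewrite rmorphB /= -!bilin_cmx /wedge_mx mxE [X in _ + X]mxE. Qed.

Lemma wedge_dxdy (A : 'M[R]_n) (p u v : plane R n) :
  wedge_mx dx (cmx A) dy p u v = (bilin A u.1 v.2 - bilin A v.1 u.2)%:C.
Proof. by rewrite rmorphB /= -!bilin_cmx /wedge_mx mxE [X in _ + X]mxE. Qed.

Lemma ipiE : ipi = 'i%C * pi%:C :> R[i].
Proof. 
apply/eqP; rewrite eq_complex Re_mul Im_mul /=.
by apply/andP; split; apply/eqP; ring.
Qed.

Lemma ipi_neq0 : ipi != 0 :> R[i].
Proof. by rewrite eq_complex /= eqxx (gt_eqF (pi_gt0 R)). Qed.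

Lemma E_transitionsE al be lam (p : plane R n) :
  E_transitions eps tau a al be lam p =
  expi (- (2%:R * pi * dotv (intv (a *m lam.1)) p.2)).
Proof. by []. Qed.

Lemma is_diff_E_phase (v : 'cV[R]_n) (p : plane R n) :
  is_diff p (fun p => - (2%:R * pi * dotv v p.2)) (fun u => - (2%:R * pi * dotv v u.2)).
Proof. exact: is_diffN (is_diffZ (2%:R * pi) (is_diff_row v^T (is_diff_snd p))). Qed.

Lemma E_id_twisted_line_bundle : id_twisted_line_bundle (E_transitions eps tau a).
Proof.
split; first by move=> *; exact: expi_neq0.
split=> [al be lam|al be ga lam mu p _ _].
  apply: (@csmooth_on_subset _ _ _ setT) => //.
  exact: csmooth_expi (is_diff_E_phase (intv (a *m lam.1))).
rewrite !E_transitionsE -expiD /= mulmxDr intvD.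
set x := intv (a *m lam.1); set y := intv (a *m mu.1).
(* The second factor is evaluated at [p.2 + intv lam.2], so the two phases differ by [2 pi] times
   the integer [dotv (a *m mu.1) lam.2]; a factor 1 compensates. *)
rewrite -[LHS]mulr1 -(expi_2pi_int (dotv (a *m mu.1) lam.2)) -expiD -dotv_intv.
congr expi; rewrite -/y dotvDr ![dotv _ p.2]dotvC dotvDr; ring.
Qed.

(** For a fixed tangent vector, the coefficient is a sum of a linear functional of [s p.1], a linear
    functional of [p.1] and a constant, to which the differentiation rules apply. *)
Lemma E_connectionE al v : E_connection T eps tau s q al ^~ v =
  (fun p => - (2%:R * ipi) * (dotv v.2 (s p.1))%:C
            + - ipi * (dotv (tau *m v.1) p.1)%:C
            + - (2%:R * ipi) * ((cmx q)^T *m T *m dy v) 0 0).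
Proof.
apply/funext => p; rewrite /E_connection mulmxDl mxE.
rewrite -[((cmx (s _))^T *m _) 0 0]/(dotv _ _) dotv_cmx.
rewrite -[((cmx p.1)^T *m _ *m _) 0 0]/(bilin _ _ _) bilin_cmx bilinE.
rewrite (dotvC (s _)) (dotvC p.1) mulrDr mulNr -addrA [X in _ + X]addrC addrA.
by rewrite [- ipi * _]mulNr.
Qed.

Lemma is_cdiff_E_connection al v p : smooth_on setT s ->
  is_cdiff p (E_connection T eps tau s q al ^~ v)
   (fun u => - (2%:R * ipi) * (dotv v.2 (jac s p.1 *m u.1))%:C
            + - ipi * (dotv (tau *m v.1) u.1)%:C + 0).
Proof.
move=> s_smooth; rewrite E_connectionE.
have sd := is_diff_comp (is_diff_fst p) (is_diff_jac p.1 s_smooth).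
exact: is_cdiffD (is_cdiffD (is_cdiffM _ (is_cdiff_real (is_diff_row v.2^T sd)))
  (is_cdiffM _ (is_cdiff_real (is_diff_row (tau *m v.1)^T (is_diff_fst p)))))
  (is_cdiff_cst _ _).
Qed.

(** The differential of [- pi i x^t tau dx] is exactly the 1-connection, and the term in [q] is
    closed; only the derivative of [s] survives. *)
Lemma E_curvature al p u v : smooth_on setT s ->
  curvature (E_connection T eps tau s q) al p u v =
  curv_form (jac s p.1) (- (2%:R * ipi)) p u v.
Proof.
move=> s_smooth; rewrite /curvature /local_curvature /dform.
rewrite (cderiveE _ (is_cdiff_E_connection al v p s_smooth)).
rewrite (cderiveE _ (is_cdiff_E_connection al u p s_smooth)).
rewrite /= wedge_dxdx rmorphB /curv_form -!cmx_tr !bilin_cmx.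
rewrite ![bilin tau _ _]bilinE.
rewrite ![bilin _ u.1 v.2]bilin_tr ![bilin _ v.1 u.2]bilin_tr !bilinE.
rewrite ![dotv (tau *m _) _]dotvC; ring.
Qed.

(** Under [x' = x + v], the change [a v] of [s] is cancelled by the logarithmic derivative of the
    transition function, and the change of [x^t tau dx] leaves the 0-connection. *)
Lemma E_twisted_connection : smooth_on setT s ->
  (forall x v, s (x + intv v) = s x + intv (a *m v)) ->
  twisted_connection (E_transitions eps tau a) (E_connection T eps tau s q).
Proof.
move=> s_smooth s_shift; split=> [al|al be lam p u _].
  split=> [p _ c u v|v].
    rewrite /E_connection dy_linear dx_linear.
    move: (dx u) (dx v) (dy u) (dy v) => xu xv yu yv.
    by rewrite !mulmx_row_linear; ring.
  apply: (@csmooth_on_subset _ _ _ setT) => //; rewrite E_connectionE.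
  have s1 : smooth_on [set: plane R n] (fun p => s p.1).
    exact: smooth_comp_affine is_diff_fst s_smooth.
  have p1 : smooth_on [set: plane R n] fst := smooth_affine is_diff_fst.
  exact: csmoothD (csmoothD (csmoothM _ (csmooth_real (smooth_row _ s1)))
    (csmoothM _ (csmooth_real (smooth_row _ p1)))) (csmooth_cst _).
rewrite (cderiveE _ (is_cdiff_expi (is_diff_E_phase (intv (a *m lam.1)) p))).
rewrite E_transitionsE mulrC mulfK ?expi_neq0//.
rewrite -[E_connection T eps tau s q be _ _]/((E_connection T eps tau s q be ^~ u) _).
rewrite -[E_connection T eps tau s q al p u]/((E_connection T eps tau s q al ^~ u) _).
rewrite !E_connectionE /= s_shift !dotvDr !rmorphD /=.
rewrite -[in RHS]/(bilin _ _ _) bilin_cmx bilinE (dotvC (intv lam.1)).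
rewrite (dotvC u.2 (intv _)) rmorphN !rmorphM /= rmorph_nat ipiE; ring.
Qed.

Lemma twisted_integrableP : 0 < eps -> smooth_on setT s ->
  (forall x v, s (x + intv v) = s x + intv (a *m v)) ->
  Immx T \in unitmx ->
  twisted_integrable_connection T (E_transitions eps tau a) (E_connection T eps tau s q)
  <-> forall x, (cmx (jac s x) *m T)^T = cmx (jac s x) *m T.
Proof.
move=> eps0 s_smooth s_shift Yu.
have c0 : - (2%:R * ipi) != 0 :> R[i] by rewrite oppr_eq0 mulf_neq0 ?ipi_neq0 ?pnatr_eq0.
have part02E al p u v : part02 T (curvature (E_connection T eps tau s q) al) p u v =
    part02 T (curv_form (jac s p.1) (- (2%:R * ipi))) p u v.
  by rewrite /part02 !E_curvature.
split=> [[_ _ H] x|H].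
  (* The curvature vanishes only at points of boxes, so [x] is moved into the unit cube, which does
     not change the Jacobian. The curvature depends on [p] through [p.1] alone, so [y = 0] will
     do. *)
  have [v xv] := floor_shift x; have [l xl] := in_box_cover eps _ eps0 xv.
  have [m ym] : exists m, in_box eps m (0 : 'cV[R]_n).
    by apply: in_box_cover => // j; rewrite mxE lexx ltr01.
  rewrite -(jac_periodic _ _ s_smooth s_shift x v).
  pose p : plane R n := (x + intv v, 0).
  apply/(part02_eq0P T (jac s p.1) _ p Yu c0) => u w.
  by rewrite -(part02E (l, m)); apply: H.
split; [exact: E_id_twisted_line_bundle | exact: E_twisted_connection |].
move=> al p u v _; rewrite part02E.
by have [_ symJ] := part02_eq0P T (jac s p.1) _ p Yu c0; exact: symJ.
Qed.

End ComplexLineBundle.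

(** * The graph and its twisted line bundle on the mirror torus *)

Section SymplecticSide.
Context {R : realType} {n : nat}.
Context (T : 'M[R[i]]_n) (eps : R) (tau : 'M[R]_n) (a : 'M[int]_n).
Context (s : 'cV[R]_n -> 'cV[R]_n) (q : 'cV[R]_n).
Context (s_smooth : smooth_on setT s).
Context (s_shift : forall x v, s (x + intv v) = s x + intv (a *m v)).

(** Discreteness of the lattice, which separates the vertical translates of the graph from one
    another. *)
Lemma intv_small (v : 'cV[int]_n) :
  (forall i, `|(intv v : 'cV[R]_n) i 0| < 1) -> v = 0.
Proof.
move=> v1; apply/matrixP => i j; rewrite (ord1 j) mxE.
have := v1 i; rewrite mxE -intr_norm -(@mulr1z R 1) ltr_int.
by case: (v i 0) => // -[].
Qed.

(** Translating the graph by [(v, w)] gives its vertical translate by [w - a v], so vertical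
    translates exhaust the preimage. *)
Lemma graph_lagrP (p : plane R n) :
  graph_lagr s p <-> exists mu, p.2 = s p.1 + intv mu.
Proof.
split=> [[x [lam ->]] /=|[mu pE]].
  by exists (lam.2 - a *m lam.1); rewrite s_shift intvB addrA addrAC addrK.
case: p pE => x _ /= ->; exists x, (0, mu); rewrite /intp /= intv0.
have -> : graph_map s x + (0, intv mu) = (x + 0, s x + intv mu) by [].
by rewrite addr0.
Qed.

Lemma smooth_graph_translate (w : 'cV[R]_n) :
  smooth_on setT (fun x => (x, s x + w) : plane R n).
Proof.
by apply: smooth_pair; [exact: smooth_id | exact: smoothD s_smooth (smooth_cst w)].
Qed.

Lemma is_diff_graph_translate (w x : 'cV[R]_n) :
  is_diff x (fun x => (x, s x + w) : plane R n) (fun u => (u, jac s x *m u)).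
Proof.
have ds := is_diff_comp (is_diff_jac x s_smooth) (is_diff_addr w (s x)).
exact: is_diff_ext (is_diff_pair (is_diff_idfun x) ds) _ _.
Qed.

Lemma submanifold_graph_lagr : submanifold n (graph_lagr s).
Proof.
move=> p /graph_lagrP[mu pE].
(* The vertical displacement from the sheet through [p]. Other sheets have a nonzero integer
   displacement, so the unit ball cuts out this sheet alone; the first projection inverts its
   parametrization. *)
pose f (y : plane R n) := y.2 - (s y.1 + intv mu).
have f_cont : continuous f.
  move=> y; apply: cvgB; first exact: cvg_snd.
  apply: cvgD; last exact: cvg_cst.
  apply: continuous_comp; first exact: cvg_fst.
  exact: differentiable_continuous (smooth_differentiable s_smooth _).
exists (f @^-1` ball 0 1), (fun x => (x, s x + intv mu)); split.
- by apply: open_comp => //; exact: ball_open.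
- by rewrite /= /f pE subrr; exact: ballxx.
- split.
  + exact: smooth_graph_translate.
  + by move=> x u v; rewrite (diffE_of (is_diff_graph_translate (intv mu) x)) => -[].
  + exists fst; split=> //; apply: continuous_subspaceT => y; exact: cvg_fst.
apply/seteqP; split=> [_ [x _ <-]|y [/graph_lagrP[nu yE]]].
  split; first by apply/graph_lagrP; exists mu.
  by rewrite /= /f subrr; exact: ballxx.
rewrite /= /f yE opprD addrACA subrr add0r -intvB => nu_mu.
exists y.1 => //; suff -> : mu = nu by rewrite -yE; case: (y).
apply/esym/eqP; rewrite -subr_eq0; apply/eqP/intv_small => i.
by have [_ /(_ i 0)] := nu_mu; rewrite mxE /ball /= sub0r normrN.
Qed.

(** Along a curve in the preimage, [y - s x] is integral near 0 and continuous at 0, hence constant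
    near 0, and its derivative vanishes. Conversely, the sheet through [p] contains the lift of the
    line in direction [u.1]. *)
Lemma tangent_graphP (p u : plane R n) : graph_lagr s p ->
  tangent (graph_lagr s) p u <-> u.2 = jac s p.1 *m u.1.
Proof.
move=> /graph_lagrP[mu pE]; split=> [[gamma [g0 gM gu]]|uE]; last first.
  pose l (t : R) := p.1 + t *: u.1.
  have dl t : is_diff t l (fun h => h *: u.1) := is_diff_line p.1 u.1 t.
  exists (fun t => (l t, s (l t) + intv mu)); split.
  - by rewrite /l scale0r addr0 -pE; case: (p).
  - by near=> t; apply/graph_lagrP; exists mu.
  have dgr := is_diff_graph_translate (intv mu) (l 0).
  have := is_diff_derive (1 : R) (is_diff_comp (dl 0) dgr).
  rewrite /= !scale1r /l scale0r addr0 -uE.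
  by rewrite (_ : (u.1, u.2) = u)//; case: (u).
have dg : is_diff (0 : R) gamma (fun h => h *: u).
  have [gd gE] := gu; split; first exact/derivable1_diffP.
  by apply/funext => h; rewrite deriv1E// derive1E gE.
have dg1 := is_diff_comp dg (is_diff_fst (gamma 0)).
have dg2 := is_diff_comp dg (is_diff_snd (gamma 0)).
have ds := is_diff_comp dg1 (is_diff_jac (gamma 0).1 s_smooth).
have dF := is_diffB dg2 ds.
set F := (_ - _) in dF.
have F0 : F 0 = intv mu by rewrite /F !fctE /= g0 pE addrAC subrr add0r.
have F_cont := differentiable_continuous (differentiable_of dF).
(* Near 0, [F t] lies at distance less than 1 from [intv mu] and is itself a lattice vector, so
   [intv_small] identifies the two. *)
have F_cst : \forall t \near (0 : R), F t = intv mu.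
  have F1 : \forall t \near (0 : R), ball (intv mu) 1 (F t).
    by rewrite -F0; apply: F_cont; exact: nbhsx_ballx.
  near=> t.
  have /graph_lagrP[nu gE] : graph_lagr s (gamma t) by near: t.
  have FE : F t = intv nu by rewrite /F !fctE /= gE addrAC subrr add0r.
  have : ball (intv mu) 1 (F t) by near: t.
  rewrite FE => mu_nu; congr intv; apply/esym/eqP; rewrite -subr_eq0.
  apply/eqP/intv_small => i.
  by have [_ /(_ i 0)] := mu_nu; rewrite intvB !mxE /ball /= distrC.
have [_ F'] := is_diff_derive (1 : R) dF.
have : 'D_1 F 0 = 0 by rewrite (near_eq_derive _ F_cst) derive_cst.
rewrite F' !fctE /= !scale1r g0 => /eqP; rewrite subr_eq0 => /eqP ->.
by [].
Unshelve. all: by end_near.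
Qed.

Lemma sympl_formE p u v : sympl_form (mirror T tau) p u v =
  (2%:R * pi * (bilin (omega_mat T) u.1 v.2 - bilin (omega_mat T) v.1 u.2))%:C.
Proof. by rewrite /= wedge_dxdy -rmorphM. Qed.

Lemma B_fieldE p u v : B_field (mirror T tau) p u v =
  (2%:R * pi * (bilin (B_mat T) u.1 v.2 - bilin (B_mat T) v.1 u.2)
   + pi * (bilin tau u.1 v.1 - bilin tau v.1 u.1))%:C.
Proof. by rewrite /= wedge_dxdy wedge_dxdx -!rmorphM -rmorphD. Qed.

Lemma pi2_neq0 : 2%:R * pi != 0 :> R.
Proof. by rewrite mulf_neq0 ?pnatr_eq0// gt_eqF// pi_gt0. Qed.

(** On tangent vectors [(u, S u)] and [(v, S v)], the symplectic form is [2 pi] times the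
    antisymmetrization of [omega_mat T *m S]. *)
Lemma lagrangian_graphP : lagrangian n (sympl_form (mirror T tau)) (graph_lagr s) <->
  forall x, (omega_mat T *m jac s x)^T = omega_mat T *m jac s x.
Proof.
split=> [[_ H] x|H].
  apply/bilin_symP => u v.
  have xL : graph_lagr s (x, s x) by apply/graph_lagrP; exists 0; rewrite intv0 addr0.
  have := H (x, s x) (u, jac s x *m u) (v, jac s x *m v) xL.
  rewrite !tangent_graphP// sympl_formE => /(_ erefl erefl) /= /complexI /eqP.
  by rewrite mulf_eq0 (negPf pi2_neq0) subr_eq0 !bilin_mulmxr => /eqP.
split; first exact: submanifold_graph_lagr.
move=> p u v pL /(tangent_graphP _ _ pL) uE /(tangent_graphP _ _ pL) vE.
have /bilin_symP symJ := H p.1.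
by rewrite sympl_formE uE vE !bilin_mulmxr symJ subrr mulr0.
Qed.

Local Notation tauZ := (tau_intR tau).
Local Notation ord_sum t v w :=
  (\sum_(i < n) \sum_(j < n | (i < j)%N) t i j * v i 0 * w j 0).

(** [tau_int] is alternating, so its entries below the diagonal are minus the transposed ones above
    it and the diagonal is zero. *)
Lemma tau_int_bilin (v w : 'cV[int]_n) :
  bilin (tau_int tau) v w = ord_sum (tau_int tau) v w - ord_sum (tau_int tau) w v.
Proof.
have bE : bilin (tau_int tau) v w = \sum_i \sum_j v i 0 * tau_int tau i j * w j 0.
  rewrite bilinE /dotv mxE; apply: eq_bigr => i _.
  rewrite !mxE big_distrr /=; apply: eq_bigr => j _; exact: mulrA.
rewrite bE [X in _ = _ - X](exchange_big_dep xpredT)//= -sumrB; apply: eq_bigr => i _.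
rewrite [X in _ = X - _]big_mkcond [X in _ = _ - X]big_mkcond -sumrB.
apply: eq_bigr => j _; rewrite /tau_int !mxE.
by case: ltngtP => _; ring.
Qed.

Lemma L_transitionsE (c c' : gidx (graph_gerbe tau eps s a)) v x :
  L_transitions tau eps s a c c' v x =
  expi (- (pi * (dotv (tauZ^T *m intv v) x + (ord_sum (tau_int tau) v v)%:~R))).
Proof. by rewrite /L_transitions /dotv trmx_mul trmxK. Qed.

Lemma is_diff_L_phase (w : 'cV[R]_n) (k : R) x :
  is_diff x (fun x => - (pi * (dotv w x + k))) (fun u => - (pi * dotv w u)).
Proof.
have dw := is_diff_comp (is_diff_row w^T (is_diff_idfun x)) (is_diff_addr k _).
exact: is_diffN (is_diffZ pi dw).
Qed.

(** Write [(v, w)] for the sum over [i < j]. The correction [(v, v)] changes by [(v, w) + (w, v)]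
    under addition, while shifting [x] by [v] produces [(w, v) - (v, w)]. The discrepancy is twice
    the integer [(v, w)], hence a multiple of [2 pi] in the phase. *)
Lemma L_id_twisted_line_bundle : id_twisted_line_bundle (L_transitions tau eps s a).
Proof.
split; first by move=> *; exact: expi_neq0.
split=> [c c' v|c c' c'' v w x _ _].
  apply: (@csmooth_on_subset _ _ _ setT) => //.
  rewrite (_ : L_transitions _ _ _ _ _ _ _ = fun x => expi
    (- (pi * (dotv (tauZ^T *m intv v) x + (ord_sum (tau_int tau) v v)%:~R)))).
    exact: csmooth_expi (is_diff_L_phase _ _).
  by apply/funext => x; rewrite L_transitionsE.
rewrite !L_transitionsE -expiD.
pose c1 := ord_sum (tau_int tau) v w.
rewrite -[LHS]mulr1 -(expi_2pi_int (- c1)) -expiD.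
congr expi.
have wv : dotv (tauZ^T *m intv w) (intv v) = (bilin (tau_int tau) w v)%:~R.
  by rewrite bilinE -dotv_intv /dotv trmx_mul trmxK -!mulmxA /intv map_mxM.
have sumD : ord_sum (tau_int tau) (v + w) (v + w) =
    ord_sum (tau_int tau) v v + ord_sum (tau_int tau) w w + ord_sum (tau_int tau) v w
    + ord_sum (tau_int tau) w v.
  rewrite -!big_split /=; apply: eq_bigr => i _; rewrite -!big_split /=.
  by apply: eq_bigr => j _; rewrite !mxE; ring.
rewrite sumD /= dotvDr wv tau_int_bilin -/c1 intvD mulmxDr.
rewrite ![dotv _ x]dotvC dotvDr.
move: c1 (ord_sum _ v v) (ord_sum _ w w) (ord_sum _ w v) => c1 c2 c3 c4.
rewrite !(intrD, intrN, mulrNz); ring.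
Qed.

Lemma bilin_tau_split x y : bilin tau x y = bilin tauZ x y + bilin (tau_frac tau) x y.
Proof. by rewrite -bilin_mxD addrC subrK. Qed.

Lemma L_connectionE c v : L_connection tau eps s a q c ^~ v =
  (fun x => - ipi * (dotv (tau *m v) x)%:C + - (2%:R * ipi) * (dotv q v)%:C).
Proof.
apply/funext => x; rewrite /L_connection.
rewrite -[((cmx x)^T *m cmx tauZ *m _) 0 0]/(bilin _ _ _) bilin_cmx.
rewrite -[((cmx x)^T *m _ *m _) 0 0]/(bilin _ _ _) bilin_cmx.
rewrite -[((cmx q)^T *m _) 0 0]/(dotv _ _) dotv_cmx (dotvC (tau *m v)) -bilinE.
rewrite bilin_tau_split rmorphD /=; ring.
Qed.

Lemma is_cdiff_L_connection c v x :
  is_cdiff x (L_connection tau eps s a q c ^~ v) (fun u => - ipi * (bilin tau u v)%:C).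
Proof.
have -> : (fun u => - ipi * (bilin tau u v)%:C) =
    (fun u => - ipi * (dotv (tau *m v) u)%:C + 0).
  by apply: funext => u; rewrite addr0 bilinE dotvC.
rewrite L_connectionE.
have dv := is_diff_row (tau *m v)^T (is_diff_idfun x).
exact: is_cdiffD (is_cdiffM _ (is_cdiff_real dv)) (is_cdiff_cst x _).
Qed.

Lemma is_diff_restr_coord mu x :
  is_diff x (restr_coord (torus_gerbe eps (tau_frac tau)) (graph_map s) (@y_shift n) mu)
    (fun u => (u, jac s x *m u)).
Proof.
apply: is_diff_ext (is_diff_graph_translate (intv mu) x) _ _ => // y.
by rewrite /restr_coord /graph_map /= /intp /= intv0; congr pair; rewrite /= addr0.
Qed.

(** Under [x' = x + v] the connection form changes by [- pi i v^t tau dx]; the transition function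
    accounts for the part in [tau_intR], and the rest is the 0-connection of the gerbe of
    [tau_frac]. *)
Lemma L_twisted_connection :
  twisted_connection (L_transitions tau eps s a) (L_connection tau eps s a q).
Proof.
split=> [c|c c' v x u _].
  split=> [x _ k u v|v].
    have LE w := congr1 (@^~ x) (L_connectionE c w).
    rewrite (LE u) (LE v) (LE (k *: u + v)) !(dotvC (tau *m _)) -!bilinE.
    by rewrite bilinDr bilinZr dotvDr dotvZr !rmorphD !rmorphM /=; ring.
  apply: (@csmooth_on_subset _ _ _ setT) => //; rewrite L_connectionE.
  exact: csmoothD (csmoothM _ (csmooth_real (smooth_row _ smooth_id))) (csmooth_cst _).
(* The 0-connection sees only the first lattice component, which is [v] because the shifts [y_shift]
   are vertical. *)
have -> : conn0 (g := graph_gerbe tau eps s a) c c' v x u =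
    - ipi * (bilin (tau_frac tau) (intv v) u)%:C.
  rewrite /= /pullback1 (diffE_of (is_diff_restr_coord _ _)) /=.
  by rewrite addr0 subr0 -bilin_cmx.
rewrite (_ : L_transitions _ _ _ _ _ _ _ = fun x => expi
    (- (pi * (dotv (tauZ^T *m intv v) x + (ord_sum (tau_int tau) v v)%:~R)))); last first.
  by apply/funext => y; rewrite L_transitionsE.
rewrite (cderiveE _ (is_cdiff_expi (is_diff_L_phase _ _ x))) mulrC mulfK ?expi_neq0//.
rewrite -[L_connection tau eps s a q c' _ _]/((L_connection tau eps s a q c' ^~ u) _).
rewrite -[L_connection tau eps s a q c x u]/((L_connection tau eps s a q c ^~ u) _).
rewrite !L_connectionE /= dotvDr rmorphD /= (dotvC _ (intv v)) -bilinE.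
rewrite bilin_tau_split rmorphD /=.
have -> : dotv (tauZ^T *m intv v) u = bilin tauZ (intv v) u.
  by rewrite /dotv /bilin trmx_mul trmxK.
rewrite rmorphN rmorphM /= ipiE; ring.
Qed.

(** Both sides contain [- pi i dx^t tau dx]. What remains is that the pullback of
    [2 pi dx^t B_mat dy], the antisymmetrization of [B_mat T *m S], vanishes. *)
Lemma L_curvatureP c x u v :
  local_curvature (L_connection tau eps s a q) c x u v
    = - 'i%C * pullback2 (graph_incl tau eps s a c) (B_field (mirror T tau)) x u v
  <-> bilin (B_mat T *m jac s x) u v = bilin (B_mat T *m jac s x) v u.
Proof.
rewrite /local_curvature /dform !(cderiveE _ (is_cdiff_L_connection _ _ x)).
rewrite /pullback2 B_fieldE !(diffE_of (is_diff_restr_coord _ _)) /= !bilin_mulmxr ipiE.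
set b := bilin _ u v; set b' := bilin _ v u.
set t := bilin tau u v; set t' := bilin tau v u.
have -> : - ('i%C * pi%:C) * t%:C - - ('i%C * pi%:C) * t'%:C =
    - 'i%C * (pi * (t - t'))%:C.
  by rewrite rmorphM rmorphB /=; ring.
have i0 : - 'i%C != 0 :> R[i] by rewrite oppr_eq0 eq_complex /= oner_eq0 andbF.
split=> [/(mulfI i0)/complexI/eqP|->]; last by rewrite subrr mulr0 add0r.
rewrite -subr_eq0 opprD addrCA subrr addr0 oppr_eq0 mulf_eq0 (negPf pi2_neq0) subr_eq0.
by move/eqP.
Qed.

Lemma L_curvature_graphP : 0 < eps ->
  (forall c x u v, chart (g := graph_gerbe tau eps s a) c x ->
     local_curvature (L_connection tau eps s a q) c x u v
     = - 'i%C * pullback2 (graph_incl tau eps s a c) (B_field (mirror T tau)) x u v)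
  <-> forall x, (B_mat T *m jac s x)^T = B_mat T *m jac s x.
Proof.
move=> eps0; split=> [H x|H c x u v _]; last first.
  by apply/L_curvatureP; have /bilin_symP -> := H x.
have [v xv] := floor_shift x; have [l xl] := in_box_cover eps _ eps0 xv.
(* The vertical shift [w] of the patch brings the point of the graph over [x + intv v] into the unit
   cube, hence into a box. *)
have [w yw] := floor_shift (s (x + intv v)); have [m ym] := in_box_cover eps _ eps0 yw.
rewrite -(jac_periodic _ _ s_smooth s_shift x v).
apply/bilin_symP => u u'; apply/(L_curvatureP ((l, m), w)); apply: H => /=.
by rewrite /restr_coord /graph_map /= intv0 addr0.
Qed.

End SymplecticSide.

(** * Comparison of the two symmetry conditions *)

Theorem proposition5p10 (R : realType) (n : nat)
  (T : 'M[R[i]]_n)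
  (ImT_pos : forall x : 'cV[R]_n, x != 0 -> 0 < (x^T *m Immx T *m x) 0 0)
  (detT : \det T != 0)
  (tau : 'M[R]_n) (tau_alt : tau^T = - tau)
  (a : 'M[int]_n)
  (s : 'cV[R]_n -> 'cV[R]_n) (s_smooth : smooth_on [set: 'cV[R]_n] s)
  (s_shift : forall (x : 'cV[R]_n) (j : 'I_n),
     s (x + delta_mx j 0) = s x + intv (col j a))
  (q : 'cV[R]_n)
  (eps : R) (eps_pos : 0 < eps) (eps_small : eps < 6%:R^-1) :
  twisted_integrable_connection T
    (E_transitions eps tau a) (E_connection T eps tau s q)
  <->
  lagrangian n (sympl_form (mirror T tau)) (graph_lagr s) /\
  [/\ id_twisted_line_bundle (L_transitions tau eps s a),
      twisted_connection (L_transitions tau eps s a) (L_connection tau eps s a q) &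
      forall (c : gidx (graph_gerbe tau eps s a)) (x u v : 'cV[R]_n),
        chart c x ->
        local_curvature (L_connection tau eps s a q) c x u v
        = - 'i%C * pullback2 (graph_incl tau eps s a c)
                     (B_field (mirror T tau)) x u v].
Proof.
have s_intv := quasi_periodic_intv a s s_shift.
have Yu : Immx T \in unitmx := pos_unitmx _ ImT_pos.
have Tu : T \in unitmx by rewrite unitmxE unitfE.
rewrite (twisted_integrableP T eps tau a s q eps_pos s_smooth s_intv Yu).
rewrite (lagrangian_graphP T tau a s s_smooth s_intv).
(* [mirror_symP] splits the symmetry of [S *m T] into the [omega_mat] half, which is the Lagrangian
   condition, and the [B_mat] half, which is the curvature condition. *)
split=> [H|[omega_sym [_ _ B_sym]] x].
  split=> [x|]; first by have [] := (mirror_symP T (jac s x) Tu).1 (H x).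
  split; [exact: L_id_twisted_line_bundle | exact: L_twisted_connection |].
  apply/(L_curvature_graphP T eps tau a s q s_smooth s_intv eps_pos) => x.
  by have [] := (mirror_symP T (jac s x) Tu).1 (H x).
apply/(mirror_symP T _ Tu); split; first exact: omega_sym.
exact: (L_curvature_graphP T eps tau a s q s_smooth s_intv eps_pos).1 B_sym x.
Qed.
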